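(* Let $(F_n)_{n\ge 0}$ be the Fibonacci sequence, defined by $F_0=0$, $F_1=1$ and $F_{n+2}=F_{n+1}+F_n$ for all $n\ge 0$. Let $p$ be a prime. \begin{itemize} \item[(i)] If $p\equiv 1\pmod 4$, then $4F_p=u^2-pv^2$ holds for infinitely many pairs $(u,v)$ of positive integers. \item[(ii)] If $p\equiv -1\pmod 4$, then there exist integers $u$ and $v$ such that $4F_p=5u^2+pv^2$. \end{itemize} *)

(* Defs.v *)
From mathcomp Require Import all_boot.

Fixpoint fib (n : nat) : nat :=
  match n with
  | 0 => 0
  | 1 => 1
  | (m.+1 as k).+1 => fib k + fib m
  end.

(* Main.v *)
Require Import Defs.
From mathcomp Require Import classical_sets cardinality.
From mathcomp Require Import all_boot all_order all_algebra all_field.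
From mathcomp Require Import ring zify.

(** Let [S] and [N] be the quadratic residues and non-residues mod [p] and let
    [z] be a primitive [p]-th root of unity. Then [(x^p - y^p) / (x - y) = P Q],
    where [P] and [Q] are the products of [x - z^a y] over [S] and [N]. Expanding
    [P] over the subsets of [S], the coefficient of [z^j] depends only on the
    quadratic character of [j], so that [P] and [Q] are [(U +- V g) / 2] with
    [g] the quadratic Gauss sum and [U], [V] integral forms in [x], [y]. As
    [g^2 = (-1)^((p-1)/2) p], this is Gauss's identity
    [4 (x^p - y^p) / (x - y) = U^2 - (-1)^((p-1)/2) p V^2].
    At the golden ratio and its conjugate the left-hand side is [4 F_p]. Taking
    complements of subsets of [S] shows that [U] and [V] are symmetric in [x], [y]
    if [p = 1 mod 4], hence integers there, and that [U] is antisymmetric and [V]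
    symmetric if [p = -1 mod 4], hence [U^2 = 5 u^2] there.
    For [p = 1 mod 4], Gauss's identity at [x = y = 1] produces a unit of norm -1
    of the quadratic field of discriminant [p]; multiplying by its square
    turns one solution into infinitely many. *)

Set Implicit Arguments.
Unset Strict Implicit.
Unset Printing Implicit Defensive.

Import Order.TTheory GRing.Theory Num.Theory.
Local Open Scope ring_scope.

(** A sum that a reindexing multiplies by some [b != 1] must vanish; this serves both the sum of the
    residues and the sum of the roots of unity. *)
Lemma mulf_fixed_eq0 (R : idomainType) (b s : R) : b != 1 -> b * s = s -> s = 0.
Proof.
move=> b1 /eqP; rewrite -subr_eq0 -{2}[s]mul1r -mulrBl mulf_eq0 subr_eq0.
by rewrite (negPf b1) => /eqP.
Qed.

(** * Quadratic residues and non-residues modulo an odd prime *)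

Section QuadraticResidues.

Variables (p : nat) (p_pr : prime p) (p_odd : odd p).
Implicit Types a b : 'F_p.

(* Euler's criterion is taken as the definition of quadratic (non-)residues. *)
Definition qres : {set 'F_p} := [set a | a ^+ p./2 == 1].
Definition nres : {set 'F_p} := [set a | a ^+ p./2 == -1].

Let p_gt2 : (2 < p)%N. Proof. exact: odd_prime_gt2. Qed.
Let half_gt0 : (0 < p./2)%N. Proof. by rewrite half_gt0 ltnW. Qed.
Let pE : p = (p./2 + p./2).+1.
Proof. by rewrite addnn -{1}(odd_double_half p) p_odd. Qed.

Lemma Fp_1_neqN1 : (1 == -1 :> 'F_p) = false.
Proof.
apply/negP; rewrite -addr_eq0 -mulr2n => /eqP two0.
have := dvdn_pcharf (pchar_Fp p_pr) 2; rewrite two0 eqxx.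
by move=> /(@dvdn_leq p 2 isT); rewrite leqNgt p_gt2.
Qed.

Lemma qres0 : 0 \notin qres.
Proof. by rewrite inE expr0n eqn0Ngt half_gt0 eq_sym oner_eq0. Qed.

Lemma nres0 : 0 \notin nres.
Proof. by rewrite inE expr0n eqn0Ngt half_gt0 eq_sym oppr_eq0 oner_eq0. Qed.

Lemma qres1 : 1 \in qres. Proof. by rewrite inE expr1n. Qed.

Lemma qres_neq0 a : a \in qres -> a != 0.
Proof. by apply: contraTneq => ->; exact: qres0. Qed.

Lemma nres_neq0 a : a \in nres -> a != 0.
Proof. by apply: contraTneq => ->; exact: nres0. Qed.

(** By Fermat, [a ^+ p./2] squares to 1 for nonzero [a], so it is 1 or -1, and these differ because
    [p] is odd. *)
Lemma nresE a : (a \in nres) = (a != 0) && (a \notin qres).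
Proof.
have [->|a0] := eqVneq a 0; first by rewrite (negPf nres0).
have /eqP: a ^+ p./2 ^+ 2 = 1.
  apply: (mulfI a0); rewrite mulr1 -exprM muln2 -addnn -exprS -pE.
  by rewrite -{2}(expf_card a) card_Fp.
rewrite /= sqrf_eq1 !inE => /orP[]/eqP->; first by rewrite eqxx Fp_1_neqN1.
by rewrite eqxx eq_sym Fp_1_neqN1.
Qed.

Lemma mem_qres_mull a b : a \in qres -> (a * b \in qres) = (b \in qres).
Proof. by rewrite !inE exprMn => /eqP->; rewrite mul1r. Qed.

Lemma mem_nres_mull a b : a \in qres -> (a * b \in nres) = (b \in nres).
Proof. by rewrite !inE exprMn => /eqP->; rewrite mul1r. Qed.

Lemma mem_nres_mul_qres a b : a \in nres -> (a * b \in nres) = (b \in qres).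
Proof. by rewrite !inE exprMn => /eqP->; rewrite mulN1r eqr_opp. Qed.

Lemma mem_qres_mul_nres a b : a \in nres -> (a * b \in qres) = (b \in nres).
Proof. by rewrite !inE exprMn => /eqP->; rewrite mulN1r eqr_oppLR. Qed.

Lemma big_Fp_split (V : Type) (idx : V) (op : Monoid.com_law idx)
    (f : 'F_p -> V) :
  \big[op/idx]_a f a =
  op (f 0) (op (\big[op/idx]_(a in qres) f a) (\big[op/idx]_(a in nres) f a)).
Proof.
rewrite (bigD1 0) //= (bigID (fun a => a \in qres)) /=; congr (op _ (op _ _)).
  apply: eq_bigl => a; have [->|//] := eqVneq a 0.
  by rewrite (negPf qres0).
by apply: eq_bigl => a; rewrite nresE.
Qed.

Lemma card_qres_le : (#|qres| <= p./2)%N.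
Proof.
rewrite cardE; apply: max_unity_roots => //; last exact: enum_uniq.
by apply/allP => a; rewrite mem_enum inE unity_rootE.
Qed.

Lemma card_qresDnres : (#|qres| + #|nres| = p./2 + p./2)%N.
Proof.
have := big_Fp_split addn (fun=> 1%N); rewrite !sum1_card card_Fp //.
by rewrite {1}pE => -[].
Qed.

(** The polynomial X^((p-1)/2) - 1 has at most (p-1)/2 roots, too few to exhaust the p - 1 nonzero
    classes. *)
Lemma nres_ex : {n | n \in nres}.
Proof.
apply/sigW/set0Pn; rewrite -card_gt0.
have := card_qresDnres; have := card_qres_le; have := half_gt0; lia.
Qed.

Lemma card_nres : #|nres| = #|qres|.
Proof.
have [n nN] := nres_ex.
rewrite -(card_imset qres (mulfI (nres_neq0 nN))); congr #|pred_of_set _|.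
apply/setP => a; apply/idP/imsetP => [aN|[b bS ->]].
  exists (n^-1 * a); last by rewrite mulVKf // nres_neq0.
  by rewrite -(mem_nres_mul_qres _ nN) mulVKf // nres_neq0.
by rewrite mem_nres_mul_qres.
Qed.

Lemma card_qres : #|qres| = p./2.
Proof. by have := card_qresDnres; rewrite card_nres; lia. Qed.

(** Multiplication by a residue [b != 1] permutes [qres]. Such a [b] exists because (p-1)/2 > 1; for
    p = 3 the only residue is 1 and the sum is not 0. *)
Lemma sum_qres : (3 < p)%N -> \sum_(a in qres) a = 0.
Proof.
move=> p_gt3; have [b bS b1] : exists2 b, b \in qres & b != 1.
  have : (0 < #|qres :\ 1%R|)%N.
    have := cardsD1 1%R qres; rewrite qres1 card_qres add1n => /eqP.
    by rewrite -ltnS => /eqP<-; lia.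
  by rewrite card_gt0 => /set0Pn[b /setD1P[b1 bS]]; exists b.
apply: (mulf_fixed_eq0 b1).
rewrite [RHS](reindex_inj (mulfI (qres_neq0 bS))) mulr_sumr.
by apply: eq_bigl => a; rewrite mem_qres_mull.
Qed.

Lemma mem_qres_opp a : ~~ odd p./2 -> (- a \in qres) = (a \in qres).
Proof. by move=> hp; rewrite !inE exprNn -signr_odd (negPf hp) mul1r. Qed.

Lemma mem_qres_oppN a : odd p./2 -> (- a \in qres) = (a \in nres).
Proof.
by move=> hp; rewrite !inE exprNn -signr_odd hp mulN1r eqr_oppLR.
Qed.

(** * Gauss sums and Gauss's identity *)

Section GaussIdentity.

Variables (K : fieldType) (z : K) (z_prim : p.-primitive_root z).

(** An additive character of the prime field: the exponent is the natural representative of [a], and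
    additivity holds because z^p = 1. *)
Definition Fp_exp a : K := z ^+ a.

Lemma Fp_exp0 : Fp_exp 0 = 1. Proof. by []. Qed.

Lemma Fp_expD a b : Fp_exp (a + b) = Fp_exp a * Fp_exp b.
Proof.
rewrite /Fp_exp -exprD -(prim_expr_mod z_prim (a + b)%N); congr (_ ^+ _).
by congr (_ %% _)%N; exact: Fp_cast.
Qed.

Lemma Fp_exp1 : Fp_exp 1 != 1.
Proof.
rewrite /Fp_exp -(prim_order_dvd z_prim) /=.
rewrite Fp_cast // modn_small ?prime_gt1 // dvdn1.
by rewrite gtn_eqF ?prime_gt1.
Qed.

Lemma Fp_exp_sum (I : Type) (r : seq I) (P : pred I) (f : I -> 'F_p) :
  Fp_exp (\sum_(i <- r | P i) f i) = \prod_(i <- r | P i) Fp_exp (f i).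
Proof. exact: (big_morph Fp_exp Fp_expD Fp_exp0). Qed.

Lemma sum_Fp_exp : \sum_a Fp_exp a = 0.
Proof.
apply: (mulf_fixed_eq0 Fp_exp1).
rewrite [RHS](reindex_inj (addrI (1 : 'F_p))) mulr_sumr.
by apply: eq_bigr => a _; rewrite Fp_expD.
Qed.

Lemma sum_Fp_expM b : \sum_a Fp_exp (a * b) = (b == 0)%:R * p%:R.
Proof.
have [->|b0] := eqVneq b 0.
  under eq_bigr do rewrite mulr0.
  by rewrite sumr_const card_Fp // mul1r.
by have := sum_Fp_exp; rewrite (reindex_inj (mulIf b0)) mul0r.
Qed.

Definition legendre a : K := (a \in qres)%:R - (a \in nres)%:R.

Lemma legendre0 : legendre 0 = 0.
Proof. by rewrite /legendre (negPf qres0) (negPf nres0) subrr. Qed.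

Lemma legendre_qres a : a \in qres -> legendre a = 1.
Proof. by move=> aS; rewrite /legendre nresE aS andbF subr0. Qed.

Lemma legendre_nres a : a \in nres -> legendre a = -1.
Proof.
move=> aN; rewrite /legendre aN.
by move: aN; rewrite nresE => /andP[_ /negPf->]; rewrite sub0r.
Qed.

Lemma legendreM a b : legendre (a * b) = legendre a * legendre b.
Proof.
have [->|a0] := eqVneq a 0; first by rewrite mul0r legendre0 mul0r.
have [aS|aS] := boolP (a \in qres).
  by rewrite (legendre_qres aS) mul1r /legendre mem_qres_mull // mem_nres_mull.
have aN : a \in nres by rewrite nresE a0.
rewrite (legendre_nres aN) mulN1r /legendre mem_qres_mul_nres //.
by rewrite mem_nres_mul_qres // opprB.
Qed.

Lemma legendreN1 : legendre (-1) = (-1) ^+ p./2.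
Proof.
rewrite -signr_odd; case: (boolP (odd p./2)) => hp.
  by rewrite expr1 legendre_nres // inE -signr_odd hp.
by rewrite legendre_qres // mem_qres_opp ?qres1.
Qed.

Lemma sum_legendreM (f : 'F_p -> K) :
  \sum_a legendre a * f a = \sum_(a in qres) f a - \sum_(a in nres) f a.
Proof.
rewrite big_Fp_split /= legendre0 mul0r add0r -sumrN; congr (_ + _).
  by apply: eq_bigr => a /legendre_qres->; rewrite mul1r.
by apply: eq_bigr => a /legendre_nres->; rewrite mulN1r.
Qed.

Lemma sum_legendre : \sum_a legendre a = 0.
Proof.
have := sum_legendreM (fun=> 1); rewrite !sumr_const card_nres subrr => E.
by rewrite -[RHS]E; apply: eq_bigr => a _; rewrite mulr1.
Qed.

Definition gauss_sum : K := \sum_a legendre a * Fp_exp a.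

Lemma gauss_sum_sqr : gauss_sum ^+ 2 = (-1) ^+ p./2 * p%:R.
Proof.
(* In the double sum over a and b, substitute b = a t for nonzero a; the square of the Legendre
   symbol of a is then 1. *)
have -> : gauss_sum ^+ 2 =
    \sum_t legendre t * \sum_(a | a != 0) Fp_exp (a * (1 + t)).
  rewrite expr2 {1}/gauss_sum mulr_suml (bigD1 0) //= legendre0 !mul0r add0r.
  under [RHS]eq_bigr do rewrite mulr_sumr.
  rewrite [RHS]exchange_big /=; apply: eq_bigr => a a0.
  rewrite /gauss_sum mulr_sumr (reindex_inj (mulfI a0)).
  apply: eq_bigr => t _; rewrite legendreM [a * (1 + t)]mulrDr mulr1 Fp_expD.
  have la : legendre a ^+ 2 = 1.
    case: (boolP (a \in qres)) => [/legendre_qres->|aS]; first by rewrite expr1n.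
    by rewrite legendre_nres ?nresE ?a0 // sqrrN expr1n.
  by rewrite -[RHS]mul1r -[X in _ = X * _]la; ring.
(* By orthogonality the inner sum, which omits a = 0, is p - 1 if t = -1 and -1 otherwise. *)
transitivity (\sum_t (legendre t * ((t == -1)%:R * p%:R) - legendre t)).
  apply: eq_bigr => t _; rewrite -[in RHS](mulr1 (legendre t)) -!mulrA.
  rewrite -mulrBr mul1r; congr (_ * _).
  have := sum_Fp_expM (1 + t); rewrite (bigD1 0) //= mul0r Fp_exp0.
  by rewrite [1 + t]addrC addr_eq0 => <-; rewrite [1 + _]addrC addrK.
rewrite sumrB sum_legendre subr0 (bigD1 (-1)) //= eqxx mul1r legendreN1.
rewrite big1 ?addr0 // => t /negPf->.
by rewrite mul0r mulr0.
Qed.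

Lemma prod_Fp_sub (x y : K) : y != 0 ->
  \prod_(a | a != 0) (x - Fp_exp a * y) = \sum_(i < p) y ^+ (p.-1 - i) * x ^+ i.
Proof.
move=> y0.
have polyE : \prod_(a | a != 0) ('X - (Fp_exp a)%:P) =
    \sum_(i < p) 'X^i :> {poly K}.
  (* After multiplication by X - 1, the missing factor at a = 0, both sides are X^p - 1. *)
  apply: (mulfI (monic_neq0 (monicXsubC 1))).
  rewrite polyC1 -subrX1 -(factor_Xn_sub_1 z_prim) -[in RHS](Fp_cast p_pr).
  by rewrite big_mkord [RHS](bigD1 ord0).
transitivity (\prod_(a | a != 0) (y * ('X - (Fp_exp a)%:P).[x / y])).
  by apply: eq_bigr => a _; rewrite hornerXsubC mulrBr mulrCA divff // mulr1 mulrC.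
rewrite big_split /= prodr_const -horner_prod polyE horner_sum mulr_sumr.
have -> : #|[pred a : 'F_p | a != 0]| = p.-1.
  by have := cardC1 (0 : 'F_p); rewrite card_Fp.
apply: eq_bigr => i _; rewrite hornerXn expr_div_n mulrCA mulrC; congr (_ * _).
by rewrite expfB_cond ?(negPf y0) ?add0n -1?ltnS ?prednK ?prime_gt0.
Qed.

(** The coefficient of z^j in the expanded product over [qres]: [J] is the set of factors from which
    the term in [y] is chosen. *)
Definition coef_subset_sum (x y : K) j : K :=
  \sum_(J : {set 'F_p} | (J \subset qres) && (\sum_(a in J) a == j))
    x ^+ (p./2 - #|J|) * (- y) ^+ #|J|.

(** The parameter [b] covers both products of the factorization: b = 1 gives the one over [qres], a
    non-residue b the one over [nres]. *)
Lemma prod_qres_expand (x y : K) b :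
  \prod_(a in qres) (x - Fp_exp (b * a) * y) =
  \sum_j coef_subset_sum x y j * Fp_exp (b * j).
Proof.
transitivity (\sum_(J : {set 'F_p} | J \subset qres)
    x ^+ (p./2 - #|J|) * (- y) ^+ #|J| * Fp_exp (b * \sum_(a in J) a)).
  rewrite big_mkcond /=.
  (* Outside [qres] the factor is written 0 + 1, so that the product over the whole field
     distributes over all subsets; those not inside [qres] contribute 0. *)
  rewrite (eq_bigr (fun a => (if a \in qres then - y * Fp_exp (b * a) else 0)
                             + (if a \in qres then x else 1))); last first.
    by move=> a _; case: ifP => _; [rewrite addrC mulNr mulrC | rewrite add0r].
  rewrite bigA_distr [RHS]big_mkcond /=; apply: eq_bigr => J _.
  case: ifP => [JS|/subsetPn[a aJ aS]]; last first.
    by rewrite (bigD1 a) //= aJ (negPf aS) mul0r.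
  rewrite (bigID (fun a => a \in J)) /= mulrC [RHS]mulrAC -[RHS]mulrA.
  congr (_ * _).
    rewrite -card_qres -cardsDS // -prodr_const [RHS]big_mkcond [LHS]big_mkcond /=.
    by apply: eq_bigr => a _; rewrite in_setD; case: (a \in J).
  rewrite mulrC mulr_sumr Fp_exp_sum -prodr_const -big_split /=.
  by apply: eq_bigr => a aJ; rewrite aJ (subsetP JS).
rewrite (partition_big (fun J : {set 'F_p} => \sum_(a in J) a) predT) //=.
apply: eq_bigr => j _; rewrite mulr_suml.
by apply: eq_bigr => J /andP[_ /eqP->].
Qed.

(** Scaling by [b] permutes the subsets of [qres], keeps their sizes and multiplies their sums by
    [b]. *)
Lemma coef_subset_sum_qresM (x y : K) b j : b \in qres ->
  coef_subset_sum x y (b * j) = coef_subset_sum x y j.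
Proof.
move=> bS; have b0 := qres_neq0 bS; have bI := mulfI b0.
rewrite /coef_subset_sum (reindex_inj (imset_inj bI)) /=; apply: eq_big => J.
  rewrite big_imset /=; last by move=> ? ? _ _ /bI.
  rewrite -mulr_sumr (inj_eq bI); congr (_ && _).
  apply/subsetP/subsetP => JS a.
    by move=> aJ; rewrite -(mem_qres_mull _ bS) JS // imset_f.
  by move=> /imsetP[c cJ ->]; rewrite mem_qres_mull // JS.
by rewrite card_imset.
Qed.

(* Replacing a subset of [qres] by its complement exchanges [x] and [y] and
   negates the sum, because [qres] sums to 0. *)
Lemma coef_subset_sumC (x y : K) j : (3 < p)%N ->
  coef_subset_sum y x j = (-1) ^+ p./2 * coef_subset_sum x y (- j).
Proof.
move=> p_gt3; pose C J := qres :\: J.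
have CK (J : {set 'F_p}) : J \subset qres -> C (C J) = J.
  by move=> JS; rewrite /C setDDr setDv set0U; apply/setIidPr.
rewrite /coef_subset_sum (reindex_onto C C); last by move=> J /andP[/CK].
rewrite mulr_sumr; apply: eq_big => J.
  rewrite subsetDl /=; have [JS|JS] := boolP (J \subset qres); last first.
    rewrite (_ : (C (C J) == J) = false) ?andbF //.
    by apply: contraNF JS => /eqP<-; rewrite subsetDl.
  rewrite CK // eqxx andbT /=.
  have := sum_qres p_gt3; rewrite (big_setID J) /= (setIidPr JS) => /eqP.
  by rewrite addr_eq0 => /eqP->; rewrite eqr_opp.
move=> /andP[_ /eqP CJ]; have JS : J \subset qres by rewrite -CJ subsetDl.
have Jm : (#|J| <= p./2)%N by rewrite -card_qres subset_leq_card.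
rewrite cardsDS // card_qres subKn // (exprNn x) (exprNn y).
have -> : (-1) ^+ p./2 = (-1) ^+ (p./2 - #|J|) * (-1) ^+ #|J| :> K.
  by rewrite -exprD subnK.
move: (sqrr_sign K #|J|) ((-1) ^+ (p./2 - #|J|)) (x ^+ _) (y ^+ _).
move: ((-1) ^+ #|J|) => s s2 t xk yk.
by rewrite -[LHS]mulr1 -[X in _ * X = _]s2; ring.
Qed.

Let c := coef_subset_sum.

(** With U and V the two squared forms on the right and g = h0 - h1 the difference of the Gauss
    periods, h0 + h1 = -1 gives 2P = U + V g and 2Q = U - V g. *)
Lemma gauss_identity (x y : K) n : y != 0 -> n \in nres ->
  4 * \sum_(i < p) y ^+ (p.-1 - i) * x ^+ i =
  (2 * c x y 0 - c x y 1 - c x y n) ^+ 2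
  - (-1) ^+ p./2 * p%:R * (c x y 1 - c x y n) ^+ 2.
Proof.
move=> y0 nN; have n0 := nres_neq0 nN.
pose P := \prod_(a in qres) (x - Fp_exp a * y).
pose Q := \prod_(a in nres) (x - Fp_exp a * y).
pose h0 := \sum_(a in qres) Fp_exp a; pose h1 := \sum_(a in nres) Fp_exp a.
have hD : 1 + (h0 + h1) = 0 by rewrite -sum_Fp_exp big_Fp_split.
have hB : (h0 - h1) ^+ 2 = (-1) ^+ p./2 * p%:R.
  by rewrite -gauss_sum_sqr /gauss_sum sum_legendreM.
have cS j : j \in qres -> c x y j = c x y 1.
  by move=> jS; rewrite -[j]mulr1 /c coef_subset_sum_qresM.
(* Here j / n is a residue, being a quotient of two non-residues. *)
have cN j : j \in nres -> c x y j = c x y n.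
  move=> jN; rewrite -[j](mulfVK n0) /c coef_subset_sum_qresM //.
  by rewrite -(mem_nres_mul_qres _ nN) mulrC mulfVK.
have PE : P = c x y 0 + (c x y 1 * h0 + c x y n * h1).
  transitivity (\prod_(a in qres) (x - Fp_exp (1 * a) * y)).
    by apply: eq_bigr => a _; rewrite mul1r.
  rewrite prod_qres_expand big_Fp_split /= mulr0 mulr1 !mulr_sumr.
  congr (_ + (_ + _)); apply: eq_bigr => j jS; rewrite mul1r -/c.
    by rewrite cS.
  by rewrite cN.
have QE : Q = c x y 0 + (c x y 1 * h1 + c x y n * h0).
  rewrite /Q (reindex_inj (mulfI n0)).
  under eq_bigl do rewrite mem_nres_mul_qres //.
  rewrite prod_qres_expand big_Fp_split /= mulr0 mulr1 !mulr_sumr.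
  congr (_ + (_ + _)).
    rewrite [RHS](reindex_inj (mulfI n0)).
    under [RHS]eq_bigl do rewrite mem_nres_mul_qres //.
    by apply: eq_bigr => j jS; rewrite -/c cS.
  rewrite [RHS](reindex_inj (mulfI n0)).
  under [RHS]eq_bigl do rewrite mem_qres_mul_nres //.
  by apply: eq_bigr => j jS; rewrite -/c cN.
have PQ : P * Q = \sum_(i < p) y ^+ (p.-1 - i) * x ^+ i.
  rewrite -prod_Fp_sub // [RHS]big_mkcond big_Fp_split /= mul1r.
  congr (_ * _); apply: eq_bigr => a aS; first by rewrite (qres_neq0 aS).
  by rewrite (nres_neq0 aS).
rewrite -PQ -hB PE QE.
have -> : h1 = - 1 - h0 by apply/eqP; rewrite -subr_eq0 -hD; apply/eqP; ring.
ring.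
Qed.

End GaussIdentity.
End QuadraticResidues.

(** * The golden ratio, Binet's formula and conjugation in Z[phi] *)

Section GoldenRatio.

Definition golden : algC := (1 + sqrtC 5) / 2.
Definition golden_conj : algC := (1 - sqrtC 5) / 2.
Local Notation phi := golden.
Local Notation psi := golden_conj.

Lemma golden_add : phi + psi = 1.
Proof. by rewrite /golden /golden_conj; field. Qed.

Lemma golden_sub : phi - psi = sqrtC 5.
Proof. by rewrite /golden /golden_conj; field. Qed.

Lemma golden_sqr : phi ^+ 2 = phi + 1.
Proof.
have -> : phi ^+ 2 = (1 + 2 * sqrtC 5 + sqrtC 5 ^+ 2) / 4.
  by rewrite /golden; field.
by rewrite sqrtCK /golden; field.
Qed.

Lemma golden_conj_sqr : psi ^+ 2 = psi + 1.
Proof.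
have -> : psi ^+ 2 = (1 - 2 * sqrtC 5 + sqrtC 5 ^+ 2) / 4.
  by rewrite /golden_conj; field.
by rewrite sqrtCK /golden_conj; field.
Qed.

Lemma golden_sub_neq0 : phi - psi != 0.
Proof. by rewrite golden_sub sqrtC_eq0 pnatr_eq0. Qed.

Lemma golden_conj_neq0 : psi != 0.
Proof.
apply/eqP => psi0; have := golden_conj_sqr.
by rewrite psi0 expr0n add0r => /esym/eqP; rewrite oner_eq0.
Qed.

Lemma binet n : (phi - psi) * (fib n)%:R = phi ^+ n - psi ^+ n.
Proof.
elim/ltn_ind: n => -[|[|n]] IHn; first by rewrite mulr0 !expr0 subrr.
  by rewrite mulr1 !expr1.
rewrite (_ : fib n.+2 = fib n.+1 + fib n)%N // natrD mulrDr !IHn //.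
rewrite -[n.+2]addn2 !exprD golden_sqr golden_conj_sqr !exprS; ring.
Qed.

Lemma fib_golden_sum n :
  (fib n)%:R = \sum_(i < n) psi ^+ (n.-1 - i) * phi ^+ i.
Proof.
apply: (mulfI golden_sub_neq0); rewrite binet; apply: oppr_inj.
by rewrite opprB subrXX -[RHS]mulNr opprB.
Qed.

(* [z] lies in Z[phi] and [w] is its Galois conjugate. *)
Definition golden_conjugates (z w : algC) : Prop :=
  exists A B : int, z = A%:~R + B%:~R * phi /\ w = A%:~R + B%:~R * psi.

Lemma golden_conjugatesD z w z' w' : golden_conjugates z w ->
  golden_conjugates z' w' -> golden_conjugates (z + z') (w + w').
Proof.
move=> [A [B [-> ->]]] [A' [B' [-> ->]]]; exists (A + A'), (B + B').
by rewrite !rmorphD /=; split; ring.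
Qed.

Lemma golden_conjugatesM z w z' w' : golden_conjugates z w ->
  golden_conjugates z' w' -> golden_conjugates (z * z') (w * w').
Proof.
move=> [A [B [-> ->]]] [A' [B' [-> ->]]].
(* The product formula uses only t^2 = t + 1, hence holds for both conjugates with the same integer
   coefficients. *)
have mulE t : t ^+ 2 = t + 1 -> (A%:~R + B%:~R * t) * (A'%:~R + B'%:~R * t) =
    (A * A' + B * B')%:~R + (A * B' + B * A' + B * B')%:~R * t :> algC.
  move=> t2; rewrite !rmorphD !rmorphM /=.
  transitivity (A%:~R * A'%:~R + (A%:~R * B'%:~R + B%:~R * A'%:~R) * t
    + B%:~R * B'%:~R * t ^+ 2); first by ring.
  by rewrite t2; ring.
eexists _, _; split; apply: mulE; [exact: golden_sqr|exact: golden_conj_sqr].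
Qed.

Lemma golden_conjugates_int (A : int) : golden_conjugates A%:~R A%:~R.
Proof. by exists A, 0; rewrite !mul0r !addr0. Qed.

Lemma golden_conjugatesN z w :
  golden_conjugates z w -> golden_conjugates (- z) (- w).
Proof.
move=> zw; rewrite -(mulN1r z) -(mulN1r w).
exact: golden_conjugatesM (golden_conjugates_int (-1)) zw.
Qed.

Lemma golden_conjugatesX z w n :
  golden_conjugates z w -> golden_conjugates (z ^+ n) (w ^+ n).
Proof.
move=> zw; elim: n => [|n IHn]; first exact: (golden_conjugates_int 1).
by rewrite !exprS; apply: golden_conjugatesM.
Qed.

Lemma golden_conjugates_phi : golden_conjugates phi psi.
Proof. by exists 0, 1; rewrite !add0r !mul1r. Qed.

Lemma golden_conjugates_psi : golden_conjugates psi phi.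
Proof.
exists 1, (-1); rewrite !mulN1r -golden_add addrK.
by split => //; rewrite addrC addKr.
Qed.

(** The coefficients are integral forms in x and y, so exchanging [phi] and [psi] conjugates their
    values. *)
Lemma golden_conjugates_coef p j :
  golden_conjugates (coef_subset_sum (p := p) phi psi j)
                    (coef_subset_sum psi phi j).
Proof.
apply: (big_ind2 golden_conjugates) => [||J _].
- exact: (golden_conjugates_int 0).
- by move=> *; apply: golden_conjugatesD.
by apply: golden_conjugatesM; apply: golden_conjugatesX;
  [|apply: golden_conjugatesN];
  [exact: golden_conjugates_phi|exact: golden_conjugates_psi].
Qed.

Lemma golden_conjugates_sym z :
  golden_conjugates z z -> exists A : int, z = A%:~R.
Proof.
move=> [A [B [-> /eqP]]]; rewrite -subr_eq0 opprD addrACA subrr add0r -mulrBr.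
rewrite mulf_eq0 (negPf golden_sub_neq0) orbF => /eqP->.
by exists A; rewrite mul0r addr0.
Qed.

(** The trace 2A + B vanishes, so z = A (1 - 2 phi) = - A sqrt 5. *)
Lemma golden_conjugates_anti z :
  golden_conjugates z (- z) -> exists A : int, z ^+ 2 = (5 * A ^+ 2)%:~R.
Proof.
move=> [A [B [-> E]]]; exists A.
have psiE : psi = 1 - phi by rewrite -golden_add addrC addKr.
have BE : B%:~R = - 2 * A%:~R :> algC.
  apply/eqP; rewrite -subr_eq0; apply/eqP.
  transitivity ((A%:~R + B%:~R * psi) + (A%:~R + B%:~R * phi)).
    by rewrite psiE; ring.
  by rewrite -E addNr.
rewrite BE rmorphM rmorphXn /=.
have -> : (A%:~R + -2 * A%:~R * phi) ^+ 2 =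
    A%:~R ^+ 2 * (1 - 4 * phi + 4 * phi ^+ 2) by ring.
by rewrite golden_sqr; ring.
Qed.

End GoldenRatio.

(** * Integral representations of 4 F_p, and a unit of norm -1 *)

Section Representations.

Variables (p : nat) (p_pr : prime p) (p_gt3 : (3 < p)%N).

Let p_odd : odd p.
Proof. by have [p2|//] := even_prime p_pr; move: p_gt3; rewrite p2. Qed.

Local Notation c := (@coef_subset_sum p algC).

(** Since -1 is a residue, the coefficients at j and -j agree, so each one is symmetric in x and y
    and takes an integer value at the golden ratio and its conjugate. *)
Lemma fib_prime_norm_even : ~~ odd p./2 ->
  exists u v : int, 4 * (fib p)%:Z = u ^+ 2 - p%:Z * v ^+ 2.
Proof.
move=> hp; have [z z_prim] := C_prim_root_exists (prime_gt0 p_pr).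
have [n nN] := nres_ex p_pr p_odd.
have cZ j : exists A : int, c golden golden_conj j = A%:~R.
  apply: golden_conjugates_sym.
  rewrite [X in golden_conjugates _ X](_ : _ = c golden_conj golden j).
    exact: golden_conjugates_coef.
  rewrite coef_subset_sumC // -signr_odd (negPf hp) mul1r -mulN1r.
  by rewrite coef_subset_sum_qresM // mem_qres_opp // qres1.
have := gauss_identity p_pr p_odd z_prim golden golden_conj_neq0 nN.
rewrite -fib_golden_sum -signr_odd (negPf hp) mul1r.
have [[A0 ->] [A1 ->]] := (cZ 0, cZ 1); have [An ->] := cZ n => E.
exists (2 * A0 - A1 - An), (A1 - An); apply: (@intr_inj algC).
by rewrite !(rmorphB, rmorphM, rmorphXn) /= -E.
Qed.

(** Since -1 is a non-residue it can serve as [n]. Exchanging x and y sends the coefficient at j to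
    minus the one at -j, which negates U and fixes V. *)
Lemma fib_prime_norm_odd : odd p./2 ->
  exists u v : int, 4 * (fib p)%:Z = 5 * u ^+ 2 + p%:Z * v ^+ 2.
Proof.
move=> hp; have [z z_prim] := C_prim_root_exists (prime_gt0 p_pr).
have nN : -1 \in nres p by rewrite -mem_qres_oppN // opprK qres1.
have cC j : c golden_conj golden j = - c golden golden_conj (- j).
  by rewrite coef_subset_sumC // -signr_odd hp mulN1r.
have := gauss_identity p_pr p_odd z_prim golden golden_conj_neq0 nN.
rewrite -fib_golden_sum -signr_odd hp mulN1r mulNr opprK.
set U := _ - _ - _; set V := _ - c _ _ _ => E.
have [u uE] : exists u : int, U ^+ 2 = (5 * u ^+ 2)%:~R.
  apply: golden_conjugates_anti.
  rewrite [X in golden_conjugates _ X](_ : _ = 2 * c golden_conj golden 0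
      - c golden_conj golden 1 - c golden_conj golden (-1)); last first.
    by rewrite !cC oppr0 !opprK /U; ring.
  have cN j := golden_conjugatesN (golden_conjugates_coef (p := p) j).
  do 2![apply: golden_conjugatesD; last exact: cN].
  apply: golden_conjugatesM; first exact: (golden_conjugates_int 2).
  exact: golden_conjugates_coef.
have [v vE] : exists v : int, V = v%:~R.
  apply: golden_conjugates_sym.
  rewrite [X in golden_conjugates _ X](_ : _ = 
      c golden_conj golden 1 - c golden_conj golden (-1)); last first.
    by rewrite !cC !opprK /V; ring.
  apply: golden_conjugatesD; last apply: golden_conjugatesN;
    exact: golden_conjugates_coef.
exists u, v; apply: (@intr_inj algC).
rewrite rmorphD /= -uE !(rmorphM, rmorphXn) /= -vE; exact: E.
Qed.

(* Gauss's identity at [x = y = 1] reads [4 p = U^2 - p V^2], so [p] divides [U]. *)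
Lemma norm_minus4_unit : ~~ odd p./2 ->
  exists a b : int, p%:Z * a ^+ 2 = b ^+ 2 + 4.
Proof.
move=> hp; have [z z_prim] := C_prim_root_exists (prime_gt0 p_pr).
have [n nN] := nres_ex p_pr p_odd.
have cZ j : exists A : int, c 1 1 j = A%:~R.
  exists (\sum_(J : {set 'F_p} | (J \subset qres p) && (\sum_(a in J) a == j))
            (-1) ^+ #|J|).
  rewrite rmorph_sum; apply: eq_bigr => J _ /=.
  by rewrite expr1n mul1r rmorphXn rmorphN1.
have := gauss_identity p_pr p_odd z_prim 1 (oner_neq0 _) nN.
rewrite -signr_odd (negPf hp) mul1r.
under eq_bigr do rewrite !expr1n mulr1.
rewrite sumr_const card_ord.
have [[A0 ->] [A1 ->]] := (cZ 0, cZ 1); have [An ->] := cZ n => E.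
pose U := 2 * A0 - A1 - An; pose b := A1 - An.
have {}E : U * U = p%:Z * (b ^+ 2 + 4).
  apply: (@intr_inj algC).
  have -> : (U * U)%:~R = 4 * p%:R + p%:R * (A1%:~R - An%:~R) ^+ 2 :> algC.
    by rewrite E !(rmorphB, rmorphM) /=; ring.
  by rewrite !(rmorphD, rmorphB, rmorphM, rmorphXn) /=; ring.
have : (p %| U)%Z.
  have : (p %| U * U)%Z by rewrite E dvdz_mulr.
  by rewrite !dvdzE abszM Euclid_dvdM // orbb.
move=> /dvdzP[a UE]; exists a, b.
have p0 : p%:Z != 0 by rewrite eqz_nat -lt0n prime_gt0.
by apply: (mulfI p0); rewrite -E UE; ring.
Qed.

End Representations.

(** * Infinitely many solutions of a norm equation from a single one *)

Lemma norm_form_parity (d : nat) (N u v : int) : odd d ->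
  4 * N = u ^+ 2 - d%:Z * v ^+ 2 -> exists t, u = v + 2 * t.
Proof.
move=> d_odd E.
have dE : d%:Z = 1 + 2 * d./2%:Z by have := odd_double_half d; lia.
have uE := divz_eq u 2; have vE := divz_eq v 2.
have u2 : (u %% 2)%Z = 0 \/ (u %% 2)%Z = 1 by lia.
have v2 : (v %% 2)%Z = 0 \/ (v %% 2)%Z = 1 by lia.
exists ((u %/ 2)%Z - (v %/ 2)%Z).
move: E uE vE; rewrite dE; move: (u %/ 2)%Z (v %/ 2)%Z (d./2%:Z) => q r k.
by case: u2 => ->; case: v2 => -> E uE vE; rewrite uE vE in E *; lia.
Qed.

Local Open Scope classical_set_scope.

(** Multiplying (u + v sqrt d) / 2 by the norm 1 element (X + Y sqrt d) / 2 preserves the norm and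
    strictly increases the second coordinate. *)
Lemma infinite_norm_form_solutions (d : nat) (N X Y u v : int) : odd d ->
    2 < X -> 0 < Y -> X ^+ 2 - d%:Z * Y ^+ 2 = 4 ->
    0 < u -> 0 <= v -> 4 * N = u ^+ 2 - d%:Z * v ^+ 2 ->
  infinite_set [set uv : int * int |
    [/\ 0 < uv.1, 0 < uv.2 & 4 * N = uv.1 ^+ 2 - d%:Z * uv.2 ^+ 2]].
Proof.
move=> d_odd X2 Y0 XY u0 v0 uv.
pose P (w : int * int) :=
  [/\ 0 < w.1, 0 <= w.2 & 4 * N = w.1 ^+ 2 - d%:Z * w.2 ^+ 2].
have step w : P w -> exists2 w', P w' & w.2 < w'.2.
  case: w => a b [/= a0 b0 ab].
  have [t aE] := norm_form_parity d_odd ab.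
  have [s XE] := norm_form_parity d_odd (etrans (mulr1 4) (esym XY)).
  have dE : d%:Z = 1 + 2 * d./2%:Z by have := odd_double_half d; lia.
  (* The halves of a X + d b Y and a Y + b X, made explicit through a = b + 2t, X = Y + 2s and d = 1
     + 2 (d-1)/2. *)
  pose a' := (1 + d./2%:Z) * b * Y + b * s + t * Y + 2 * t * s.
  pose b' := b * Y + t * Y + s * b.
  have a'E : 2 * a' = a * X + d%:Z * b * Y by rewrite aE XE dE /a'; ring.
  have b'E : 2 * b' = a * Y + b * X by rewrite aE XE /b'; ring.
  have aY : 0 < a * Y by rewrite mulr_gt0.
  have aX : 0 < a * X by rewrite mulr_gt0 ?(lt_trans _ X2).
  have dbY : 0 <= d%:Z * b * Y by rewrite !mulr_ge0 // ltW.
  have bX : b * 2 <= b * X by rewrite ler_wpM2l // ltW.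
  move: a' b' a'E b'E => a' b' a'E b'E.
  exists (a', b'); last by rewrite /=; lia.
  split => /=; [by lia | by lia | ].
  (* Multiplicativity of the norm: 4 * (4 N) is the product of X^2 - d Y^2 and a^2 - d b^2. *)
  apply: (@mulfI _ 4) => //.
  transitivity ((2 * a') ^+ 2 - d%:Z * (2 * b') ^+ 2); last by ring.
  by rewrite a'E b'E -{1}XY ab; ring.
have [f fP fS] : exists2 f : nat -> int * int,
    forall n, P (f n) & forall n, (f n).2 < (f n.+1).2.
  pose T := {w | P w}.
  have next (w : T) : exists w' : T, (sval w).2 < (sval w').2.
    by case: w => w Pw; have [w' Pw' ltw] := step w Pw; exists (exist _ w' Pw').
  have [g gS] := boolp.choice next.
  pose f n := iter n g (exist _ (u, v) (And3 u0 v0 uv)).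
  exists (fun n => sval (f n)) => n; first exact: svalP.
  exact: gS.
have f_mono : {homo (fun n => (f n).2) : m n / (m < n)%N >-> m < n}.
  by apply: homo_ltn => //; exact: lt_trans.
have f_inj : injective f.
  move=> m n E; case: (ltngtP m n) => // /f_mono; by rewrite E ltxx.
(* The shift drops the initial pair, whose second coordinate may be 0. *)
apply: (@sub_infinite_set _ (range (fun n => f n.+1))).
  move=> _ [n _ <-]; have [? f0 ?] := fP n; have [? _ ?] := fP n.+1.
  by split => //; exact: le_lt_trans f0 (fS n).
rewrite (eq_finite_set (inj_card_eq _)); first exact: infinite_nat.
by move=> m n _ _ /f_inj[].
Qed.

Theorem theorem1 (p : nat) (p_prime : prime p) :
  ((p%:Z = 1 %[mod 4])%Z ->
     infinite_set [set uv : int * int |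
       [/\ 0 < uv.1, 0 < uv.2 &
           4 * (fib p)%:Z = uv.1 ^+ 2 - p%:Z * uv.2 ^+ 2]]) /\
  ((p%:Z = -1 %[mod 4])%Z ->
     exists u v : int, 4 * (fib p)%:Z = 5 * u ^+ 2 + p%:Z * v ^+ 2).
Proof.
have p_gt1 := prime_gt1 p_prime.
split=> p4.
  have p_gt3 : (3 < p)%N by lia.
  have hp : ~~ odd p./2 by lia.
  have p_odd : odd p by lia.
  have [u [v uv]] := fib_prime_norm_even p_prime p_gt3 hp.
  have [a [b ab]] := norm_minus4_unit p_prime p_gt3 hp.
  (* If b = 0 then p a^2 = 4, so p divides 2^2, which is impossible for p > 3. *)
  have b0 : b != 0.
    apply/eqP => b0; move: ab; rewrite b0 => ab.
    have : (p %| 2 ^ 2)%N by apply/dvdnP; exists (`|a| ^ 2)%N; lia.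
    by rewrite Euclid_dvdX // => /andP[/dvdn_leq]; lia.
  have a0 : a != 0 by apply/eqP => a0; move: ab; rewrite a0; nia.
  have F0 : 0 < (fib p)%:Z.
    rewrite ltz_nat; case: (p) p_gt1 => // n _; elim: n => // n IHn.
    by rewrite (_ : fib n.+2 = fib n.+1 + fib n)%N // addn_gt0 IHn.
  have u0 : u != 0.
    by apply/eqP => u0; move: uv; rewrite u0; nia.
  (* [((b + a sqrt p) / 2)^2 = (b^2 + 2 + a b sqrt p) / 2] *)
  apply: (@infinite_norm_form_solutions
            p _ (b ^+ 2 + 2) `|a * b| `|u| `|v|) => //.
  - by rewrite ltrDr exprn_even_gt0.
  - by rewrite normr_gt0 mulf_neq0.
  - rewrite real_normK ?num_real // exprMn mulrA ab; ring.
  - by rewrite normr_gt0.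
  by rewrite !real_normK ?num_real.
(* For p = 3, where the residues do not sum to 0, 4 F_3 = 8 = 5 + 3. *)
have [->|p3] := eqVneq p 3; first by exists 1, 1.
by apply: fib_prime_norm_odd; lia.
Qed.
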